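(* Let $p$ be a prime with $p\equiv5\pmod 6$ and Legendre symbol $\left(\frac{-3}{p}\right)=-1$, and let $\alpha\ge0$, $n\ge0$ be integers. Then for every integer $i$ with $1\le i\le p-1$, $$\overline{S}_3\big(36p^{2\alpha+2}n+6(6i+p)p^{2\alpha+1}\big)\equiv0\pmod{12}.$$
   Context: For $|q|<1$ and a positive integer $k$, write $f_k=\prod_{j\ge1}(1-q^{kj})$. The function $\overline{S}_3(n)$ (number of $3$-Schur overpartitions of $n$) is defined by $\sum_{n\ge0}\overline{S}_3(n)q^n=\prod_{n\ge1}\frac{(1+q^{2n-1})(1-q^{3(2n-1)})}{(1+q^{3(2n-1)})(1-q^{2n-1})}=\frac{f_2^3f_3^2f_{12}}{f_1^2f_4f_6^3}$. *)

(* Defs.v *)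
From HB Require Import structures.
From mathcomp Require Import all_boot all_order all_algebra boolp.

Set Implicit Arguments.
Unset Strict Implicit.
Unset Printing Implicit Defensive.

Import GRing.Theory.
Local Open Scope ring_scope.

(* The ring R[[q]] of formal power series. A series is the family of its
   coefficients; it coerces to a function, so that [s n] is the coefficient
   of q^n in s. *)
Record fps (R : Type) := Fps { coefs : nat -> R }.
Coercion coefs : fps >-> Funclass.

HB.instance Definition _ (R : Type) := gen_eqMixin (fps R).
HB.instance Definition _ (R : Type) := gen_choiceMixin (fps R).

Lemma fpsP (R : Type) (s t : fps R) : (forall n, s n = t n) <-> s = t.
Proof.
split=> [|-> //]; case: s t => [s] [t] /= st.
by congr Fps; apply/funext.
Qed.

Section Zmodule.
Variable R : zmodType.
Implicit Types s t : fps R.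

Definition fps_zero : fps R := Fps (fun=> 0).
Definition fps_add s t : fps R := Fps (fun n => s n + t n).
Definition fps_opp s : fps R := Fps (fun n => - s n).

Lemma fps_addA : associative fps_add.
Proof. by move=> s t u; apply/fpsP => n /=; rewrite addrA. Qed.
Lemma fps_addC : commutative fps_add.
Proof. by move=> s t; apply/fpsP => n /=; rewrite addrC. Qed.
Lemma fps_add0 : left_id fps_zero fps_add.
Proof. by move=> s; apply/fpsP => n /=; rewrite add0r. Qed.
Lemma fps_addN : left_inverse fps_zero fps_opp fps_add.
Proof. by move=> s; apply/fpsP => n /=; rewrite addNr. Qed.

HB.instance Definition _ :=
  GRing.isZmodule.Build (fps R) fps_addA fps_addC fps_add0 fps_addN.

Lemma coef_fps0 n : (0 : fps R) n = 0. Proof. by []. Qed.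
Lemma coef_fpsD s t n : (s + t) n = s n + t n. Proof. by []. Qed.
Lemma coef_fpsN s n : (- s) n = - s n. Proof. by []. Qed.
Lemma coef_fpsB s t n : (s - t) n = s n - t n. Proof. by []. Qed.
End Zmodule.

Section Ring.
Variable R : comNzRingType.
Implicit Types s t u : fps R.

Definition fps_one : fps R := Fps (fun n => (n == 0%N)%:R).
Definition fps_mul s t : fps R :=
  Fps (fun n => \sum_(i < n.+1) s i * t (n - i)%N).

Definition fps_trunc N s : {poly R} := \poly_(i < N.+1) s i.

Lemma coef_fps_trunc N s n : (n <= N)%N -> (fps_trunc N s)`_n = s n.
Proof. by move=> nN; rewrite coef_poly ltnS nN. Qed.

Lemma coef_fps_mul_trunc N s t n : (n <= N)%N ->
  fps_mul s t n = (fps_trunc N s * fps_trunc N t)`_n.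
Proof.
move=> nN; rewrite coefM; apply: eq_bigr => i _.
by rewrite !coef_fps_trunc// (leq_trans _ nN)// ?leq_subr// -ltnS.
Qed.

Lemma fps_mulC : commutative fps_mul.
Proof.
by move=> s t; apply/fpsP => n; rewrite !(coef_fps_mul_trunc _ _ (leqnn n)) mulrC.
Qed.

Lemma fps_mulA : associative fps_mul.
Proof.
suff E s t u n : fps_mul s (fps_mul t u) n =
    (fps_trunc n s * (fps_trunc n t * fps_trunc n u))`_n.
  move=> s t u; apply/fpsP => n.
  by rewrite (fps_mulC (fps_mul s t)) !E mulrA mulrC.
rewrite coefM; apply: eq_bigr => i _.
rewrite (@coef_fps_mul_trunc n) ?leq_subr//.
by rewrite coef_fps_trunc// -ltnS.
Qed.

Lemma fps_mul1 : left_id fps_one fps_mul.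
Proof.
move=> s; apply/fpsP => n /=; rewrite big_ord_recl/= mul1r subn0 big1 ?addr0//.
by move=> i _; rewrite mul0r.
Qed.

Lemma fps_mulDl : left_distributive fps_mul (@fps_add R).
Proof.
move=> s t u; apply/fpsP => n /=; rewrite -big_split/=.
by apply: eq_bigr => i _; rewrite mulrDl.
Qed.

Lemma fps_one_neq0 : fps_one != 0 :> fps R.
Proof. by apply/eqP => /fpsP/(_ 0%N)/eqP; rewrite /= oner_eq0. Qed.

HB.instance Definition _ := GRing.Zmodule_isComNzRing.Build (fps R)
  fps_mulA fps_mulC fps_mul1 fps_mulDl fps_one_neq0.

Definition fpsX : fps R := Fps (fun n => (n == 1%N)%:R).

Lemma coef_fps1 n : (1 : fps R) n = (n == 0%N)%:R. Proof. by []. Qed.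
Lemma coef_fpsM s t n : (s * t) n = \sum_(i < n.+1) s i * t (n - i)%N.
Proof. by []. Qed.

Lemma coef_fpsXn k n : (fpsX ^+ k) n = (n == k)%:R.
Proof.
elim: k n => [|k IH] n; first by rewrite expr0 coef_fps1.
rewrite exprS coef_fpsM; case: n => [|n].
  by rewrite big_ord1 mul0r.
rewrite big_ord_recl mul0r add0r big_ord_recl /= mul1r IH subSS subn0 eqSS.
by rewrite big1 ?addr0// => i _; rewrite mul0r.
Qed.

End Ring.

Section UnitRing.
Variable R : comUnitRingType.
Implicit Types s t u : fps R.

Definition fps_unit : {pred fps R} := fun s => s 0%N \is a GRing.unit.

(* The first n+1 coefficients of 1/s, from the recursion
   b_0 = 1/s_0, b_n = - (s_n b_0 + ... + s_1 b_{n-1}) / s_0. *)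
Fixpoint fps_inv_seq s (n : nat) : seq R :=
  if n is m.+1 then
    let b := fps_inv_seq s m in
    rcons b (- ((s 0%N)^-1 * \sum_(i < m.+1) s (m.+1 - i)%N * b`_i))
  else [:: (s 0%N)^-1].

Definition fps_inv s : fps R :=
  if s \in fps_unit then Fps (fun n => (fps_inv_seq s n)`_n) else s.

Lemma size_fps_inv_seq s n : size (fps_inv_seq s n) = n.+1.
Proof. by elim: n => //= n IH; rewrite size_rcons IH. Qed.

Lemma nth_fps_inv_seq s n i : (i <= n)%N ->
  (fps_inv_seq s n)`_i = (fps_inv_seq s i)`_i.
Proof.
elim: n => [|n IH]; first by rewrite leqn0 => /eqP->.
rewrite leq_eqVlt => /orP[/eqP->//|iltn].
by rewrite /= nth_rcons size_fps_inv_seq iltn IH.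
Qed.

Lemma fps_mulV : {in fps_unit, left_inverse 1 fps_inv *%R}.
Proof.
move=> s su; apply/fpsP => n; rewrite /fps_inv su coef_fpsM coef_fps1.
case: n => [|n]; first by rewrite big_ord1 mulVr.
rewrite big_ord_recr /= subnn nth_rcons size_fps_inv_seq ltnn eqxx.
rewrite mulNr mulrAC mulVr// mul1r; apply/eqP; rewrite subr_eq0; apply/eqP.
by apply: eq_bigr => i _; rewrite mulrC (@nth_fps_inv_seq _ n)// -ltnS.
Qed.

Lemma fps_unitPl s t : t * s = 1 -> s \in fps_unit.
Proof.
move=> /fpsP/(_ 0%N); rewrite coef_fpsM big_ord1 => ts.
by apply/unitrPr; exists (t 0%N); rewrite mulrC.
Qed.

Lemma fps_inv_out : {in [predC fps_unit], fps_inv =1 id}.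
Proof. by move=> s; rewrite inE /= /fps_inv => /negbTE->. Qed.

HB.instance Definition _ := GRing.ComNzRing_hasMulInverse.Build (fps R)
  fps_mulV fps_unitPl fps_inv_out.

Lemma fps_unitE s : (s \is a GRing.unit) = (s 0%N \is a GRing.unit).
Proof. by []. Qed.

End UnitRing.

(* The infinite product over n >= 1 of the F n, for families such that
   F n = 1 + O(q^n): the coefficient of q^n in the finite products is then
   stationary from the n-th one on (fps_iprodE). *)
Definition fps_iprod (R : comNzRingType) (F : nat -> fps R) : fps R :=
  Fps (fun n => (\prod_(1 <= m < n.+1) F m) n).

Lemma fps_iprodE (R : comNzRingType) (F : nat -> fps R) (n N : nat) :
  (forall m i, (0 < m)%N -> (i < m)%N -> F m i = (1 : fps R) i) ->
  (n <= N)%N -> fps_iprod F n = (\prod_(1 <= m < N.+1) F m) n.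
Proof.
move=> F1; elim: N => [|N IH]; first by rewrite leqn0 => /eqP->.
rewrite leq_eqVlt => /orP[/eqP->//|nN].
rewrite big_nat_recr// IH//=; set s := \prod_(_ <= _ < _) _.
have -> : s n = (s * 1) n by rewrite mulr1.
rewrite !coef_fpsM; apply: eq_bigr => i _.
by rewrite F1// ltnS (leq_trans (leq_subr _ _)).
Qed.

Notation "''q'" := (fpsX int) (at level 0).

(* The generating function is read formally, in Z[[q]]; its product converges
   for |q| < 1, so the analytic reading yields the same coefficients. *)
Definition S3_factor (n : nat) : fps int :=
  ((1 + 'q ^+ (2 * n - 1)) * (1 - 'q ^+ (3 * (2 * n - 1)))) /
  ((1 + 'q ^+ (3 * (2 * n - 1))) * (1 - 'q ^+ (2 * n - 1))).

Definition S3bar (n : nat) : int := fps_iprod S3_factor n.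

Lemma S3_factor_denominator_unit n : (0 < n)%N ->
  (1 + 'q ^+ (3 * (2 * n - 1))) * (1 - 'q ^+ (2 * n - 1)) \is a GRing.unit.
Proof.
move=> n0; have a0 : (0 < 2 * n - 1)%N.
  by rewrite subn_gt0 (leq_trans _ (leq_pmulr 2 n0)).
rewrite unitrM !fps_unitE coef_fpsD coef_fpsB !coef_fpsXn !coef_fps1.
have -> : (0 == 2 * n - 1)%N = false by rewrite ltn_eqF.
have -> : (0 == 3 * (2 * n - 1))%N = false by rewrite ltn_eqF ?muln_gt0.
by rewrite eqxx mulr1n !mulr0n addr0 ?subr0 unitr1.
Qed.

Lemma S3_factor_eq1 n i : (0 < n)%N -> (i < n)%N ->
  S3_factor n i = (1 : fps int) i.
Proof.
move=> n0 lt_in; set a := (2 * n - 1)%N.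
pose P (s : fps int) := forall j, (j < n)%N -> s j = (1 : fps int) j.
have PM s t : P s -> P t -> P (s * t).
  move=> Ps Pt j jn; rewrite -[in RHS](mulr1 1) !coef_fpsM.
  apply: eq_bigr => k _; rewrite Ps ?Pt ?(leq_ltn_trans (leq_subr _ _))//.
  by rewrite (leq_ltn_trans _ jn)// -ltnS.
have PX b j : (n <= b)%N -> (j < n)%N -> ('q ^+ b) j = 0.
  by move=> nb jn; rewrite coef_fpsXn ltn_eqF// (leq_trans jn).
have na : (n <= a)%N by rewrite /a mul2n -addnn -addnBA// leq_addr.
have na3 : (n <= 3 * a)%N by rewrite (leq_trans na)// leq_pmull.
have PD b : (n <= b)%N -> P (1 + 'q ^+ b).
  by move=> nb j jn; rewrite coef_fpsD PX// addr0.
have PB b : (n <= b)%N -> P (1 - 'q ^+ b).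
  by move=> nb j jn; rewrite coef_fpsB PX// subr0.
have PV s : s \is a GRing.unit -> P s -> P s^-1.
  move=> su Ps j jn; rewrite -[in RHS](mulVr su) coef_fpsM big_ord_recr/=.
  rewrite subnn Ps// coef_fps1 mulr1 big1 ?add0r// => k _.
  rewrite Ps ?(leq_ltn_trans (leq_subr _ _))// coef_fps1.
  by rewrite subn_eq0 leqNgt ltn_ord mulr0.
have Pnum := PM _ _ (PD _ na) (PB _ na3).
have Pden := PM _ _ (PD _ na3) (PB _ na).
exact: (PM _ _ Pnum (PV _ (S3_factor_denominator_unit n0) Pden)).
Qed.

Lemma S3barE (n N : nat) : (n <= N)%N ->
  S3bar n = (\prod_(1 <= m < N.+1) S3_factor m) n.
Proof. exact/fps_iprodE/S3_factor_eq1. Qed.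

(* The Legendre symbol (a / p), meant for p an odd prime. *)
Definition legendre (a : int) (p : nat) : int :=
  if (p %| a)%Z then 0
  else if [exists x : 'I_p, (x%:Z ^+ 2 == a %[mod p])%Z] then 1 else -1.

(* Main.v *)
(* Write G for the generating function, phi(q) = \sum_(s in Z) q^(s^2), and
   n = 6N for the argument of S3bar; N is odd and the exponent of p in N is odd.
   Gauss's identity phi(-q) = \prod (1 - q^k) / (1 + q^k) turns the product for G
   into G(q) phi(q^3) phi(-q^2) = phi(q) phi(-q^6).

   Modulo 4, since phi = 1 + 2 theta with theta = \sum_(s > 0) q^(s^2), this
   makes G linear in theta(q), theta(q^3), theta(-q^2) and theta(-q^6), so a
   nonzero coefficient at n > 0 needs n to be k s^2 with k | 6, impossible as the
   exponent of p in n is odd.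

   Modulo 3, Frobenius gives G = phi(-q) / phi(q).  Let U(q) = G(-q) = 1 / G.  From
   phi(q)^2 + phi(-q)^2 = 2 phi(q^2)^2 and phi(q) phi(-q) = phi(-q^2)^2 one gets
   G + U = 2 U(q^2)^2, so the coefficient of G at 6N is that of U^2 at 3N, hence,
   3N being odd, up to a unit that of O = U^2 - G^2.  Finally
   O^2 = (U^6 O)(q^2) with U^6 = U(q^3)^2, which forces O to be supported on
   exponents congruent to 1 modulo 3. *)
From HB Require Import structures.
Require Import Defs.
From mathcomp Require Import all_boot all_order all_algebra finfield ring zify.

Set Implicit Arguments.
Unset Strict Implicit.
Unset Printing Implicit Defensive.

Import GRing.Theory Num.Theory.
Local Open Scope ring_scope.

(** * Substitution of -q and of powers of q; congruence of truncated series *)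

Section Substitution.
Variable R : comNzRingType.
Implicit Types s t : fps R.

Definition qneg s : fps R := Fps (fun n => (-1) ^+ n * s n).

Lemma coef_qneg s n : qneg s n = (-1) ^+ n * s n.
Proof. by []. Qed.

Lemma qneg_is_zmod_morphism : zmod_morphism qneg.
Proof. by move=> s t; apply/fpsP => n /=; rewrite mulrDr mulrN. Qed.

Lemma qneg_is_monoid_morphism : monoid_morphism qneg.
Proof.
split=> [|s t]; apply/fpsP => n /=.
  by case: n => [|n]; rewrite ?mulr1 ?mulr0.
rewrite big_distrr; apply: eq_bigr => i _ /=.
rewrite [(-1) ^+ n](_ : _ = (-1) ^+ i * (-1) ^+ (n - i)); first by ring.
by rewrite -exprD subnKC// -ltnS.
Qed.

HB.instance Definition _ :=
  GRing.isZmodMorphism.Build (fps R) (fps R) qneg qneg_is_zmod_morphism.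
HB.instance Definition _ :=
  GRing.isMonoidMorphism.Build (fps R) (fps R) qneg qneg_is_monoid_morphism.

Lemma qnegK : involutive qneg.
Proof.
by move=> s; apply/fpsP => n /=; rewrite mulrA -exprMn mulrNN mulr1 expr1n mul1r.
Qed.

Lemma qneg_Xn k : qneg (fpsX R ^+ k) = (-1) ^+ k * fpsX R ^+ k.
Proof.
rewrite rmorphXn -exprMn; congr (_ ^+ k); apply/fpsP => n.
by rewrite mulN1r /=; case: n => [|[|n]] /=; ring.
Qed.

(* s(q^(k+1)): indexing by the predecessor makes it a morphism for every k. *)
Definition qpow k s : fps R :=
  Fps (fun n => if (k.+1 %| n)%N then s (n %/ k.+1)%N else 0).

Lemma coef_qpow k s n :
  qpow k s n = if (k.+1 %| n)%N then s (n %/ k.+1)%N else 0.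
Proof. by []. Qed.

(** Truncation turns [qpow] into composition of polynomials, from which it inherits
    multiplicativity. *)
Lemma coef_qpow_trunc k s n N : (n <= N)%N ->
  qpow k s n = (fps_trunc N s \Po 'X^(k.+1))`_n.
Proof.
move=> nN; rewrite coef_comp_poly_Xn //=; case: ifP => // _.
by rewrite coef_fps_trunc// (leq_trans (leq_div _ _)).
Qed.

Lemma qpow_is_zmod_morphism k : zmod_morphism (qpow k).
Proof. by move=> s t; apply/fpsP => n /=; case: ifP; rewrite ?subr0. Qed.

Lemma qpow_is_monoid_morphism k : monoid_morphism (qpow k).
Proof.
split=> [|s t]; apply/fpsP => n.
  rewrite /=; case: ifP => [/dvdnP[m ->]|]; first by rewrite mulnK// muln_eq0 orbF.
  by case: n => //; rewrite dvdn0.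
transitivity (((fps_trunc n s * fps_trunc n t) \Po 'X^(k.+1))`_n).
  rewrite coef_comp_poly_Xn //; rewrite [LHS]/=; case: ifP => // _.
  exact/coef_fps_mul_trunc/leq_div.
rewrite comp_polyM coefM; apply: eq_bigr => i _.
by rewrite !(@coef_qpow_trunc _ _ _ n) ?leq_subr// -ltnS.
Qed.

HB.instance Definition _ k :=
  GRing.isZmodMorphism.Build (fps R) (fps R) (qpow k) (@qpow_is_zmod_morphism k).
HB.instance Definition _ k :=
  GRing.isMonoidMorphism.Build (fps R) (fps R) (qpow k)
    (@qpow_is_monoid_morphism k).

Lemma qpow_Xn k m : qpow k (fpsX R ^+ m) = fpsX R ^+ (k.+1 * m).
Proof.
apply/fpsP => n; rewrite /= !coef_fpsXn; case: ifP => [/dvdnP[j ->]|dvd_n].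
  by rewrite mulnK// mulnC eqn_pmul2l.
by case: eqP => // n_km; rewrite n_km dvdn_mulr in dvd_n.
Qed.

Lemma qpow_comp a b s : qpow a (qpow b s) = qpow (a.+1 * b.+1).-1 s.
Proof.
set c := _.-1; have Ec : c.+1 = (a.+1 * b.+1)%N by rewrite prednK ?muln_gt0.
apply/fpsP => n; rewrite /= {}Ec divnMA.
case: (boolP (a.+1 %| n)%N) => [/dvdnP[m ->]|nd].
  by rewrite mulnK// [(m * _)%N]mulnC dvdn_pmul2l.
by case: ifP => // /(dvdn_trans (dvdn_mulr _ (dvdnn _))); rewrite (negbTE nd).
Qed.

Definition eqmodX N s t := forall n, (n <= N)%N -> s n = t n.

Lemma eqmodX_mul N s s' t t' :
  eqmodX N s s' -> eqmodX N t t' -> eqmodX N (s * t) (s' * t').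
Proof.
move=> ss' tt' n nN; rewrite !coef_fpsM; apply: eq_bigr => i _.
have ? : (i <= n)%N by rewrite -ltnS.
by rewrite ss' ?tt'//; lia.
Qed.

Lemma eqmodX_qneg N s t : eqmodX N s t -> eqmodX N (qneg s) (qneg t).
Proof. by move=> st n nN /=; rewrite st. Qed.

Lemma eqmodX_qpow N k s t : eqmodX N s t -> eqmodX N (qpow k s) (qpow k t).
Proof.
by move=> st n nN /=; case: ifP => // _; rewrite st// (leq_trans (leq_div _ _)).
Qed.

Lemma eqmodX_mulXn N m s t : (N < m)%N -> eqmodX N (t + fpsX R ^+ m * s) t.
Proof.
move=> Nm n nN; rewrite coef_fpsD coef_fpsM big1 ?addr0// => i _.
by rewrite coef_fpsXn ltn_eqF ?mul0r//; have := ltn_ord i; lia.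
Qed.

End Substitution.

(* Shanks's finite form of Gauss's identity
   1 + 2 \sum_s (-1)^s z^(s^2) = \prod_k (1 - z^k) / (1 + z^k). *)
Section Gauss.
Variable R : comUnitRingType.
Variables (z : R) (P a : nat -> R).
Hypothesis z_unit : forall n, 1 + z ^+ n.+1 \is a GRing.unit.
Hypothesis P0 : P 0 = 1.
Hypothesis PS : forall n, P n.+1 * (1 + z ^+ n.+1) = P n * (1 - z ^+ n.+1).
Hypothesis a0 : a 0 = 1.
Hypothesis aS : forall n, a n.+1 * (1 - z ^+ n.+1) = a n * (1 + z ^+ n).

(** The left-hand side is constant in [n]: [aS] and then [PS] step it down to n = 0, where 1 + z^0 =
    2. *)
Let Pa n : P n * (a n.+1 * (1 - z ^+ n.+1)) = 2.
Proof.
elim: n => [|n IH]; rewrite aS; first by rewrite P0 a0 expr0; ring.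
by rewrite mulrCA PS -IH; ring.
Qed.

Let T n : R := \sum_(0 <= s < n.+1) (-1) ^+ s * a s * z ^+ (s * n.+1).

Let d n s : R := (-1) ^+ s * (a s * (1 - z ^+ s)) * z ^+ (s * n).

(** By [aS] the terms with s <= n telescope in [d], which vanishes at s = 0; the last term of
    [T n.+1] supplies the z^(n+1) share. *)
Let T_rec n :
  (1 - z ^+ n.+1) * T n.+1 - (1 + z ^+ n.+1) * T n = (1 + z ^+ n.+1) * d n.+1 n.+1.
Proof.
rewrite /T big_nat_recr//= mulrDr addrAC !mulr_sumr -sumrB.
rewrite (eq_bigr (fun s => d n.+1 s.+1 - d n.+1 s)); last first.
  move=> s _; rewrite /d aS !mulnS mulSn !exprD !exprS.
  by set x := z ^+ (s * _); set y := z ^+ n; set w := z ^+ s; ring.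
rewrite telescope_sumr// /d; rewrite expr0 subrr mulr0 mulr0 mul0r subr0.
rewrite (mulnS n.+1 n.+1) exprD.
by set x := z ^+ (_ * _); set y := z ^+ n.+1; set e := _ ^+ n.+1; ring.
Qed.

(** By [T_rec], going from n to n+1 raises P n T n by P n d (n+1) (n+1), which [Pa] evaluates as 2
    (-1)^(n+1) z^((n+1)^2). *)
Lemma gauss_finite n :
  1 + 2 * \sum_(1 <= s < n.+1) (-1) ^+ s * z ^+ (s ^ 2) =
  P n * \sum_(0 <= s < n.+1) (-1) ^+ s * a s * z ^+ (s * n.+1).
Proof.
rewrite -/(T n); elim: n => [|n IH].
  by rewrite /T big_nat1 big_geq// P0 a0 mul0n !expr0; ring.
apply: (mulIr (z_unit n)); rewrite big_nat_recr//= [2 * _]mulrDr addrA IH.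
have -> : P n.+1 * T n.+1 * (1 + z ^+ n.+1) = P n * ((1 - z ^+ n.+1) * T n.+1).
  by rewrite mulrAC PS; ring.
move/eqP: (T_rec n); rewrite subr_eq => /eqP ->.
rewrite /d mulrDr -mulnn.
transitivity (P n * T n * (1 + z ^+ n.+1) +
   (P n * (a n.+1 * (1 - z ^+ n.+1))) * ((-1) ^+ n.+1 * z ^+ (n.+1 * n.+1))
     * (1 + z ^+ n.+1)); last by ring.
by rewrite Pa; ring.
Qed.

End Gauss.

(** * Theta series and Gauss's identity for formal power series *)

Lemma eqmodXW (R : comNzRingType) N M (s t : fps R) :
  (N <= M)%N -> eqmodX M s t -> eqmodX N s t.
Proof. by move=> NM st n nN; rewrite st// (leq_trans nN). Qed.

(** Passage to the limit: exact identities between finite products give identities between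
    series. *)
Lemma eq_fps_mod (R : comNzRingType) (s t : fps R) :
  (forall N, exists s' t', [/\ eqmodX N s s', eqmodX N t t' & s' = t']) -> s = t.
Proof.
move=> st; apply/fpsP => n; have [s' [t' [ss' tt' s't']]] := st n.
by rewrite ss'// s't' tt'.
Qed.

Lemma coef_fps_sum (R : comNzRingType) I r (P : pred I) (F : I -> fps R) n :
  (\sum_(i <- r | P i) F i) n = \sum_(i <- r | P i) F i n.
Proof. exact: (big_morph (fun s : fps R => s n)). Qed.

Lemma coef_fpsMn (R : comNzRingType) (s : fps R) m n : (s *+ m) n = s n *+ m.
Proof. by elim: m => // m IH; rewrite !mulrS coef_fpsD IH. Qed.

Lemma unit_1DX (k : nat) : (0 < k)%N -> 1 + 'q ^+ k \is a GRing.unit.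
Proof.
by case: k => // k _; rewrite fps_unitE coef_fpsD coef_fpsXn coef_fps1 /= addr0.
Qed.

Lemma unit_1BX (k : nat) : (0 < k)%N -> 1 - 'q ^+ k \is a GRing.unit.
Proof.
by case: k => // k _; rewrite fps_unitE coef_fpsB coef_fpsXn coef_fps1 /= subr0.
Qed.

(** Bounding s by n loses nothing, as s <= s^2; the condition 0 < n discards s = 0. *)
Definition theta : fps int :=
  Fps (fun n => ((0 < n)%N && [exists s : 'I_n.+1, n == (s ^ 2)%N])%:R).

(* Ramanujan's phi(q) = \sum_(s in Z) q^(s^2). *)
Definition phi : fps int := 1 + theta *+ 2.

Lemma thetaP n : reflect (exists2 s, (0 < s)%N & n = (s ^ 2)%N) (theta n != 0).
Proof.
rewrite /= pnatr_eq0 eqb0 negbK; apply: (iffP andP).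
  by case=> n0 /existsP[s /eqP ns]; exists s => //; rewrite -(sqrn_gt0 s) -ns.
case=> s s0 ->; split; first by rewrite sqrn_gt0.
by apply/existsP; exists (inord s); rewrite inordK// ltnS -mulnn leq_pmulr.
Qed.

Lemma theta01 n : theta n = (theta n != 0)%:R.
Proof. by rewrite /=; case: (_ && _). Qed.

(** At most one s survives, and it has the parity of its square. *)
Lemma sum_theta n N : (n <= N)%N ->
  \sum_(1 <= s < N.+1) (-1) ^+ s * (n == (s ^ 2)%N)%:R = (-1) ^+ n * theta n.
Proof.
move=> nN; rewrite theta01; case: thetaP => [[r r0 nr]|nsq]; last first.
  rewrite mulr0 big_nat big1// => s /andP[s0 _].
  by case: eqP => [ns|]; rewrite ?mulr0//; case: nsq; exists s.
rewrite mulr1 (bigD1_seq r) ?iota_uniq//=; last first.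
  by rewrite mem_index_iota r0 ltnS (leq_trans _ nN)// nr -mulnn leq_pmulr.
rewrite nr eqxx mulr1 -signr_odd -[in RHS]signr_odd oddX /= big1 ?addr0// => s sr.
by rewrite eqn_exp2r// eq_sym (negbTE sr) mulr0.
Qed.

Definition gprod n : fps int := \prod_(1 <= k < n.+1) ((1 - 'q ^+ k) / (1 + 'q ^+ k)).

(** On the right of [gauss_finite] every term with s > 0 is divisible by q^(N+1), which leaves only
    [gprod N]. *)
Lemma gauss N : eqmodX N (qneg phi) (gprod N).
Proof.
pose a n : fps int := \prod_(0 <= s < n) ((1 + 'q ^+ s) / (1 - 'q ^+ s.+1)).
have := @gauss_finite _ 'q gprod a (fun n => unit_1DX (ltn0Sn n)) _ _ _ _ N.
have gprod0 : gprod 0 = 1 by rewrite /gprod big_geq.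
have gprodS n : gprod n.+1 * (1 + 'q ^+ n.+1) = gprod n * (1 - 'q ^+ n.+1).
  by rewrite /gprod big_nat_recr//= -mulrA divrK ?unit_1DX.
have a0 : a 0 = 1 by rewrite /a big_geq.
have aS n : a n.+1 * (1 - 'q ^+ n.+1) = a n * (1 + 'q ^+ n).
  by rewrite /a big_nat_recr//= -mulrA divrK ?unit_1BX.
move=> /(_ gprod0 gprodS a0 aS) gN n nN.
have -> : qneg phi n = (1 + 2 * \sum_(1 <= s < N.+1) (-1) ^+ s * 'q ^+ (s ^ 2)) n.
  rewrite mulr_natl coef_qneg /phi !coef_fpsD coef_fps_sum.
  under eq_bigr => s _ do
    rewrite -signr_odd mulr_sign (fun_if (fun t : fps int => t n)) coef_fpsN
      coef_fpsXn -mulr_sign signr_odd.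
  by rewrite sum_theta// coef_fps1; case: (n) => [|m] /=; ring.
rewrite gN big_ltn// a0 mul0n !expr0 !mulr1 mulrDr mulr1.
have -> : \sum_(1 <= s < N.+1) (-1) ^+ s * a s * 'q ^+ (s * N.+1) =
    'q ^+ N.+1 * \sum_(1 <= s < N.+1) (-1) ^+ s * a s * 'q ^+ (s.-1 * N.+1).
  rewrite mulr_sumr !big_nat; apply: eq_bigr => -[|s]// _.
  by rewrite mulSn exprD /=; ring.
rewrite mulrCA; exact: (eqmodX_mulXn _ _ (ltnSn N) nN).
Qed.

(** * Splitting products by parity; the generating function in terms of phi *)

Definition oddprod n : fps int :=
  \prod_(1 <= m < n.+1) ((1 + 'q ^+ (2 * m - 1)) / (1 - 'q ^+ (2 * m - 1))).

Lemma gprodSS n : gprod n.+1.*2 = gprod n.*2 *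
  ((1 - 'q ^+ n.*2.+1) / (1 + 'q ^+ n.*2.+1)) *
  ((1 - 'q ^+ n.*2.+2) / (1 + 'q ^+ n.*2.+2)).
Proof. by rewrite /gprod doubleS big_nat_recr// big_nat_recr. Qed.

Lemma oddprodS n : oddprod n.+1 =
  oddprod n * ((1 + 'q ^+ n.*2.+1) / (1 - 'q ^+ n.*2.+1)).
Proof.
rewrite /oddprod big_nat_recr//=; have -> // : (2 * n.+1 - 1 = n.*2.+1)%N by lia.
Qed.

Lemma qpow_gprodS k n : qpow k (gprod n.+1) = qpow k (gprod n) *
  ((1 - 'q ^+ (k.+1 * n.+1)) / (1 + 'q ^+ (k.+1 * n.+1))).
Proof.
rewrite /gprod big_nat_recr//= rmorphM rmorph_div ?unit_1DX//.
by rewrite rmorphB rmorphD rmorph1 /= !qpow_Xn.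
Qed.

(** The odd-indexed factors of [gprod n.*2] are inverse to those of [oddprod n]; the even-indexed
    ones form [gprod n] at q^2. *)
Lemma gprod_double n : gprod n.*2 * oddprod n = qpow 1 (gprod n).
Proof.
elim: n => [|n IH]; first by rewrite /gprod /oddprod !big_geq// rmorph1 mulr1.
rewrite gprodSS oddprodS qpow_gprodS mul2n -IH.
have -> (a b x y z : fps int) : x \is a GRing.unit -> y \is a GRing.unit ->
  a * (x / y) * z * (b * (y / x)) = a * b * z.
  move=> xu yu; transitivity (a * b * z * (x / x) * (y / y)); first by ring.
  by rewrite !divrr// !mulr1.
by [].
by rewrite unit_1BX.
by rewrite unit_1DX.
Qed.

(** Replacing q by -q inverts the odd-indexed factors and fixes the even-indexed ones. *)
Lemma qneg_gprod_double n : qneg (gprod n.*2) = oddprod n * qpow 1 (gprod n).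
Proof.
elim: n => [|n IH]; first by rewrite /gprod /oddprod !big_geq// !rmorph1 mulr1.
rewrite gprodSS oddprodS qpow_gprodS mul2n !rmorphM /= !rmorphV ?unit_1DX//=.
rewrite !rmorphB !rmorphD !rmorph1 /= !qneg_Xn IH -signr_odd -[(-1) ^+ n.*2.+2]signr_odd.
by rewrite /= odd_double expr0 expr1 mul1r mulN1r opprK; ring.
Qed.

(** The product of the two preceding identities, in which [gprod] tends to phi(-q). *)
Lemma phi_qneg : phi * qneg phi = qpow 1 (qneg phi) ^+ 2.
Proof.
apply: eq_fps_mod => N; exists (qneg (gprod N.*2) * gprod N.*2), (qpow 1 (gprod N) ^+ 2).
have gN := eqmodXW (leq_addr N N) (@gauss (N + N)); rewrite addnn in gN.
split; last by rewrite qneg_gprod_double mulrAC [_ * gprod _]mulrC gprod_double.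
  by apply: eqmodX_mul => //; rewrite -[phi]qnegK; exact: eqmodX_qneg.
by rewrite !expr2; apply: eqmodX_mul; exact/eqmodX_qpow/gauss.
Qed.

Definition S3ser : fps int := Fps S3bar.

(** Finite form of G(q) A(q^3) = A(q), where A is the limit of [oddprod]. *)
Lemma S3_prod_oddprod N :
  (\prod_(1 <= m < N.+1) S3_factor m) * qpow 2 (oddprod N) = oddprod N.
Proof.
rewrite rmorph_prod -big_split /= [LHS]big_nat [RHS]big_nat.
apply: eq_bigr => m /andP[m0 _]; have o0 : (0 < 2 * m - 1)%N by lia.
rewrite /S3_factor rmorph_div ?unit_1BX// rmorphB rmorphD rmorph1 /= !qpow_Xn.
have u3 : (0 < 3 * (2 * m - 1))%N by rewrite muln_gt0.
move: (unit_1BX o0) (unit_1BX u3) (unit_1DX u3).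
set x := _ ^+ (2 * m - 1); set y := _ ^+ (3 * _) => ux uy uy'.
rewrite invrM//; transitivity ((1 + x) / (1 - x) * ((1 - y) / (1 - y)) *
  ((1 + y) / (1 + y))); first by ring.
by rewrite !divrr// !mulr1.
Qed.

(** With A the limit of [oddprod], phi(q) = A(q) phi(-q^2); this is used at q and at q^3. *)
Lemma S3ser_phi :
  S3ser * qpow 2 phi * qpow 1 (qneg phi) = phi * qpow 2 (qpow 1 (qneg phi)).
Proof.
apply: eq_fps_mod => N.
exists ((\prod_(1 <= m < N.+1) S3_factor m) * qpow 2 (qneg (gprod N.*2)) *
        qpow 1 (gprod N)), (qneg (gprod N.*2) * qpow 2 (qpow 1 (gprod N))).
have gN := eqmodXW (leq_addr N N) (@gauss (N + N)); rewrite addnn in gN.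
have /= phiN := eqmodX_qneg gN; rewrite qnegK in phiN.
split; last first.
- rewrite qneg_gprod_double rmorphM /= -{2}(S3_prod_oddprod N).
  by rewrite -!mulrA; congr (_ * (_ * _)); rewrite mulrC.
- by apply: eqmodX_mul => //; do 2!apply: eqmodX_qpow; exact: gauss.
apply: eqmodX_mul; last exact/eqmodX_qpow/gauss.
apply: eqmodX_mul; last exact: eqmodX_qpow.
by move=> n nN; rewrite [LHS](S3barE nN).
Qed.

(** * Additive theta identities *)

Lemma phiD_qneg : phi + qneg phi = qpow 3 phi *+ 2.
Proof.
rewrite /phi !rmorphD !rmorph1 /=.
suff E : theta + qneg theta = qpow 3 theta *+ 2.
  transitivity (2 + (theta + qneg theta) *+ 2); first by ring.
  by rewrite E; ring.
apply/fpsP => n; rewrite coef_fpsD coef_fpsMn coef_qneg coef_qpow.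
(* Even squares are four times squares; odd exponents cancel against their sign. *)
have [/dvdnP[m ->]|nd4] := boolP (4 %| n)%N.
  rewrite mulnK// -signr_odd oddM andbF expr0.
  suff -> : theta (m * 4)%N = theta m by ring.
  rewrite theta01 [RHS]theta01; congr (nat_of_bool _)%:R.
  apply/thetaP/thetaP => -[s s0].
    move=> ms; have : (2 %| s ^ 2)%N by rewrite -ms dvdn_mull.
    rewrite Euclid_dvdX// andbT => /dvdnP[r sr]; exists r; move: ms s0; rewrite sr.
      by case: (r).
    by rewrite expnMn => /eqP; rewrite eqn_pmul2r// => /eqP.
  by move=> ->; exists (s * 2)%N; rewrite ?muln_gt0 ?s0// expnMn.
rewrite mul0rn -signr_odd.
case: (boolP (odd n)) => [_|nodd]; first by ring.
suff -> : theta n = 0 by ring.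
apply/eqP/negPn/negP => /thetaP[s _ ns]; case/negP: nd4.
have : (2 %| s ^ 2)%N by rewrite -ns dvdn2.
by rewrite Euclid_dvdX// andbT ns => /(dvdn_exp2r 2).
Qed.

(* The difference W(q) of the two sides satisfies W(q) = -2 W(q^2). *)
Lemma phi_sqr : phi ^+ 2 + qneg phi ^+ 2 = (qpow 1 phi ^+ 2) *+ 2.
Proof.
have : phi 0 = 1 by [].
move: phiD_qneg phi_qneg; move: phi => x xD xM x0.
apply/eqP; rewrite -subr_eq0; set W := _ - _.
have WE : W = - (qpow 1 W *+ 2).
  have -> : qpow 1 W = qpow 1 x ^+ 2 + x * qneg x - qpow 3 x ^+ 2 *+ 2.
    by rewrite xM -[qpow 3 x](@qpow_comp _ 1 1) /W rmorphB rmorphD rmorphMn !rmorphXn.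
  transitivity ((x + qneg x) ^+ 2 - (x * qneg x + qpow 1 x ^+ 2) *+ 2).
    by rewrite /W; ring.
  by rewrite xD; ring.
apply/eqP/fpsP; elim/ltn_ind => n IH.
have [->|n0] := posnP n.
  by rewrite /W coef_fpsB coef_fpsMn coef_fpsD !expr2 !coef_fpsM !big_ord1 /= x0.
rewrite WE coef_fpsN coef_fpsMn coef_qpow; case: ifP => dn; last by rewrite mul0rn oppr0.
by rewrite IH ?mul0rn ?oppr0// ltn_Pdiv.
Qed.

(** * The congruence modulo 4 *)

Lemma S3ser_mod4 : exists r, S3ser = 1 +
  (theta + qpow 2 theta + qpow 1 (qneg theta) + qpow 2 (qpow 1 (qneg theta))) *+ 2
  + r *+ 4.
Proof.
have := S3ser_phi; have qphi k : qpow k phi = 1 + qpow k theta *+ 2.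
  by rewrite /phi rmorphD rmorphMn rmorph1.
have -> : qneg phi = 1 + qneg theta *+ 2 by rewrite /phi rmorphD rmorphMn rmorph1.
rewrite qphi /phi !(rmorphD, rmorphMn, rmorph1) /=.
move: theta (qpow 2 theta) (qpow 1 _) (qpow 2 (qpow 1 _)) => a b c d.
set G := S3ser => E.
(* [f] and [h] are the second and third elementary symmetric polynomials. As (1+2b)^2 (1+2c)^2 =
   1+4e, the factors 1+2b and 1+2c are their own inverses modulo 4. *)
set f := a * (b + c + d) + b * (c + d) + c * d.
set h := a * b * c + a * b * d + a * c * d + b * c * d.
set e := b + b ^+ 2 + c + c ^+ 2 + (b + b ^+ 2) * (c + c ^+ 2) *+ 4.
exists (f + h *+ 2 + (a * b * c * d) *+ 4 - e * G).
transitivity (G * (1 + b *+ 2) * (1 + c *+ 2) * ((1 + b *+ 2) * (1 + c *+ 2))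
  - (e * G) *+ 4); first by rewrite /e; ring.
by rewrite {1}E /f /h; ring.
Qed.

Lemma S3bar_mod4 p n : prime p -> (3 < p)%N -> odd (logn p n) -> (4 %| S3bar n)%Z.
Proof.
move=> pp p3 pn.
have n0 : (0 < n)%N by case: (n) pn => //; rewrite logn0.
have cop k : (0 < k < 4)%N -> coprime p k.
  move=> /andP[k0 k4]; rewrite prime_coprime//.
  by apply/negP => /(dvdn_leq k0); rewrite leqNgt (leq_trans k4).
have cop6 : coprime p 6 by rewrite -[6%N]/(2 * 3)%N coprimeMr !cop.
(* A nonzero coefficient makes m a square, and then p would divide n = m k to an even power. *)
have theta0 k m : coprime p k -> n = (m * k)%N -> theta m = 0.
  move=> pk nmk; apply/eqP/negPn/negP => /thetaP[s s0 ms]; move: pn.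
  by rewrite nmk ms mulnC logn_Gauss// lognX oddM.
have q0 k (s : fps int) : coprime p k.+1 ->
    (forall m, n = (m * k.+1)%N -> s m = 0) -> qpow k s n = 0.
  move=> pk sm; rewrite coef_qpow; case: ifP => // /dvdnP[m nm].
  by rewrite nm mulnK// sm.
have [r Er] := S3ser_mod4.
have -> : S3bar n = S3ser n by [].
rewrite Er coef_fpsD [(r *+ 4) n]coef_fpsMn coef_fpsD [X in _ + X + _]coef_fpsMn.
rewrite !coef_fpsD coef_fps1 (gtn_eqF n0).
rewrite (theta0 1%N) ?muln1 ?coprimen1//.
rewrite (q0 2%N) ?cop//; last by move=> m; apply: theta0; rewrite cop.
rewrite (q0 1%N) ?cop//; last first.
  by move=> m nm; rewrite coef_qneg (theta0 2%N) ?mulr0// cop.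
rewrite (@qpow_comp _ 2 1) (q0 5%N)//.
  by rewrite !addr0 add0r -[r n *+ 4]mulr_natr dvdz_mull.
by move=> m nm; rewrite coef_qneg (theta0 6%N) ?mulr0.
Qed.

(** * The congruence modulo 3: coefficientwise reduction and Frobenius *)

Section Map.
Variables (R S : comNzRingType) (f : {rmorphism R -> S}).

Definition map_fps (s : fps R) : fps S := Fps (fun n => f (s n)).

Lemma map_fps_is_zmod_morphism : zmod_morphism map_fps.
Proof. by move=> s t; apply/fpsP => n /=; rewrite rmorphB. Qed.

Lemma map_fps_is_monoid_morphism : monoid_morphism map_fps.
Proof.
split=> [|s t]; apply/fpsP => n /=; first by rewrite rmorph_nat.
by rewrite rmorph_sum; apply: eq_bigr => i _; rewrite rmorphM.
Qed.

HB.instance Definition _ :=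
  GRing.isZmodMorphism.Build (fps R) (fps S) map_fps map_fps_is_zmod_morphism.
HB.instance Definition _ :=
  GRing.isMonoidMorphism.Build (fps R) (fps S) map_fps map_fps_is_monoid_morphism.

Lemma map_fps_qneg s : map_fps (qneg s) = qneg (map_fps s).
Proof. by apply/fpsP => n /=; rewrite rmorphM rmorph_sign. Qed.

Lemma map_fps_qpow k s : map_fps (qpow k s) = qpow k (map_fps s).
Proof. by apply/fpsP => n /=; rewrite (fun_if f) rmorph0. Qed.

End Map.

Lemma coef_fpsX_trunc (R : comNzRingType) N (s : fps R) k n : (n <= N)%N ->
  (s ^+ k) n = (fps_trunc N s ^+ k)`_n.
Proof.
elim: k n => [|k IH] n nN; first by rewrite !expr0 coef_fps1 coef1.
rewrite !exprS coef_fpsM coefM; apply: eq_bigr => i _.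
by rewrite coef_fps_trunc ?IH ?(leq_trans (leq_subr _ _))// (leq_trans _ nN)// -ltnS.
Qed.

Section Frobenius.
Variables (p : nat) (p_prime : prime p).

(** The p-th power map is additive in characteristic p and fixes the coefficients. *)
Lemma polyFp_frobenius (P : {poly 'F_p}) : P ^+ p = P \Po 'X^p.
Proof.
have pP : p \in [pchar {poly 'F_p}] by rewrite pchar_poly pchar_Fp.
elim/poly_ind: P => [|P c IH]; first by rewrite comp_poly0 expr0n gtn_eqF ?prime_gt0.
rewrite comp_polyD comp_polyM comp_polyX comp_polyC -IH.
rewrite -!(pFrobenius_autE pP) pFrobenius_autD_comm; last exact: mulrC.
rewrite pFrobenius_autM_comm; last exact: mulrC.
rewrite !pFrobenius_autE; congr (_ + _); rewrite -rmorphXn /=; congr _%:P.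
by have := expf_card c; rewrite card_Fp.
Qed.

Lemma fpsFp_frobenius (s : fps 'F_p) : s ^+ p = qpow p.-1 s.
Proof.
apply/fpsP => n; rewrite (coef_fpsX_trunc _ _ (leqnn n)) polyFp_frobenius.
by rewrite (coef_qpow_trunc _ _ (leqnn n)) prednK ?prime_gt0.
Qed.

End Frobenius.

(* Compare the coefficients of q^(n+1) at the least n violating the claim: the
   left-hand side contributes 2 O_1 O_n, the right-hand side nothing. *)
Lemma support_mod3 (O K : fps 'F_3) : O 0%N = 0 -> O 1%N != 0 ->
  O ^+ 2 = qpow 1 (qpow 2 K * O) -> forall n, O n != 0 -> (n %% 3 = 1)%N.
Proof.
move=> O0 O1 EO; elim/ltn_ind => n IH.
have [->|n_gt0] := posnP n; first by rewrite O0 eqxx.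
have [->//|n_neq1] := eqVneq n 1%N.
have n_gt1 : (1 < n)%N by rewrite ltn_neqAle eq_sym n_neq1.
have [//|n3] := eqVneq (n %% 3)%N 1%N.
case/negP; move/fpsP/(_ n.+1): EO; rewrite expr2 coef_fpsM.
have -> : \sum_(i < n.+2) O i * O (n.+1 - i)%N = O 1%N * O n *+ 2.
  rewrite -(big_mkord xpredT (fun i => O i * O (n.+1 - i)%N)).
  rewrite big_nat_recr// big_nat_recr// big_ltn// big_ltn//= O0 subnn O0.
  rewrite subSS subn0 subSnn big_nat big1 => [|i /andP[i1 ilt]].
    by rewrite subn0; ring.
  (* If both factors are nonzero, i and n+1-i are 1 modulo 3, and then so is n. *)
  have [->|/IH Oi] := eqVneq (O i) 0; first by rewrite mul0r.
  have [->|/IH Oj] := eqVneq (O (n.+1 - i)%N) 0; first by rewrite mulr0.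
  by move: (Oi ilt) (Oj ltac:(lia)) n3; lia.
(* Here n+1 = 2m; a nonzero term has 3 | i and m-i = 1 modulo 3, which again makes n = 1 modulo
   3. *)
have -> : qpow 1 (qpow 2 K * O) n.+1 = 0.
  rewrite coef_qpow; case: ifP => // dn; rewrite coef_fpsM big1// => i _.
  rewrite coef_qpow; case: ifP => di; last by rewrite mul0r.
  have [->|/IH Oj] := eqVneq (O (n.+1 %/ 2 - i)%N) 0; first by rewrite mulr0.
  by have := ltn_ord i; move: (Oj ltac:(lia)) dn di n3; lia.
by move/eqP; rewrite -mulr_natr !mulf_eq0 (negbTE O1) /= orbF => ->.
Qed.

Lemma S3bar_mod3 N : odd N -> (3 %| S3bar (6 * N))%Z.
Proof.
have phi1 : phi 1 = 2.
  have t1 : theta 1 = 1 by rewrite theta01; case: thetaP => // [[]]; exists 1%N.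
  by rewrite /phi coef_fpsD coef_fpsMn t1.
have phi0 : phi 0 = 1 by [].
move: phi_sqr phi_qneg S3ser_phi phi0 phi1.
move: phi => f f_sqr f_qneg S3f f0 f1 oddN; pose red := map_fps (intmul (1 : 'F_3)).
have red_qneg s : red (qneg s) = qneg (red s) by exact: map_fps_qneg.
have red_qpow k s : red (qpow k s) = qpow k (red s) by exact: map_fps_qpow.
have three : 3 = 0 :> fps 'F_3.
  apply/fpsP => n; rewrite coef_fpsMn; exact: (mulrn_pchar (pchar_Fp (isT : prime 3))).
(* Modulo 3, [g] is G, [x] is phi(q) and [y] is phi(-q); [u] below is U. *)
pose g := red S3ser; pose x := red f; pose y := qneg x.
have reg (s a b : fps 'F_3) : s 0%N = 1 -> s * a = s * b -> a = b.
  by move=> s0; apply/mulrI; rewrite fps_unitE s0 unitr1.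
have x0 : x 0%N = 1 by rewrite /= f0.
have y0 : y 0%N = 1 by rewrite coef_qneg x0 mulr1.
have xy : x * y = qpow 1 y ^+ 2.
  by rewrite /y /x -red_qneg -red_qpow -rmorphM -rmorphXn f_qneg.
have gx : g * x = y.
  have : g * qpow 2 x * qpow 1 y = x * qpow 2 (qpow 1 y).
    by rewrite /g /x /y -red_qneg -!red_qpow -!rmorphM S3f.
  (* With Y = phi(-q^2), Frobenius gives g x^3 Y = x Y^3, and Y^2 = x y leaves g x = y after
     cancelling x^2 Y. *)
  rewrite -!(@fpsFp_frobenius 3)// => E.
  apply: (@reg (qpow 1 y)); first by rewrite coef_qpow dvdn0 div0n.
  apply: (@reg x) => //.
  apply: (@reg x) => //.
  transitivity (g * x ^+ 3 * qpow 1 y); first by ring.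
  rewrite E; transitivity (x * qpow 1 y * qpow 1 y ^+ 2); first by ring.
  by rewrite -xy; ring.
pose u := qneg g.
have uy : u * y = x by rewrite /u /y -rmorphM /= gx /y qnegK.
have gu : g * u = 1.
  apply: (@reg (x * y)); first by rewrite coef_fpsM big_ord1 x0 y0 mulr1.
  by transitivity ((g * x) * (u * y)); [ring | rewrite gx uy; ring].
have gDu : g + u = qpow 1 u ^+ 2 *+ 2.
  (* Multiplied by x y, the left-hand side becomes x^2 + y^2, to which [f_sqr] applies. *)
  apply: (@reg (x * y)); first by rewrite coef_fpsM big_ord1 x0 y0 mulr1.
  transitivity ((g * x) * y + (u * y) * x); first by ring.
  rewrite gx uy -!expr2 addrC.
  transitivity (qpow 1 x ^+ 2 *+ 2).
    have := congr1 (map_fps (intmul (1 : 'F_3))) f_sqr.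
    by rewrite rmorphD rmorphMn !rmorphXn /= -/red red_qneg red_qpow.
  by rewrite xy -uy rmorphM; ring.
pose O := u ^+ 2 - g ^+ 2.
have EO : O ^+ 2 = qpow 1 (qpow 2 (u ^+ 2) * O).
  have -> : O ^+ 2 = ((g + u) ^+ 2 - 4 * (g * u)) * (g + u) ^+ 2 by rewrite /O; ring.
  have -> : qpow 2 (u ^+ 2) * O = u ^+ 8 - u ^+ 4 * (g * u) ^+ 2.
    by rewrite -(@fpsFp_frobenius 3)// /O; ring.
  (* Since g + u = 2 v^2 with v = U(q^2), O^2 becomes 16 v^8 - 16 v^4, and 16 = 1 modulo 3. *)
  rewrite gDu gu expr1n !mulr1 rmorphB !rmorphXn /=.
  set v := qpow 1 u; transitivity (v ^+ 8 - v ^+ 4 + 3 * (5 * v ^+ 8 - 5 * v ^+ 4)).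
    by ring.
  by rewrite three mul0r addr0.
have g0 : g 0%N = 1.
  by have := gx => /fpsP/(_ 0%N); rewrite coef_fpsM big_ord1 x0 mulr1 y0.
have three0 : 3 = 0 :> 'F_3 by apply/val_inj.
have x1 : x 1%N = 2 by rewrite /= f1.
have coefM1 (s t : fps 'F_3) : (s * t) 1%N = s 0%N * t 1%N + s 1%N * t 0%N.
  by rewrite coef_fpsM big_ord_recl big_ord1.
have g1 : g 1%N = 2.
  have := gx => /fpsP/(_ 1%N); rewrite coefM1 coef_qneg g0 x0 x1 expr1 => E.
  transitivity (1 * 2 + g 1%N * 1 - 2 : 'F_3); first by ring.
  by rewrite E; apply/val_inj.
have u0 : u 0%N = 1 by rewrite coef_qneg g0 mulr1.
have u1 : u 1%N = 1 by rewrite coef_qneg g1; apply/val_inj.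
have O0 : O 0%N = 0 by rewrite coef_fpsB !expr2 !coef_fpsM !big_ord1 u0 g0 subrr.
have O1 : O 1%N != 0.
  rewrite coef_fpsB !expr2 !coefM1 u0 g0 u1 g1.
  by apply/eqP => /(congr1 val).
have O3N : O (3 * N)%N = 0.
  by apply/eqP/negPn/negP => /(support_mod3 O0 O1 EO); rewrite modnMr.
have u3N : (u ^+ 2) (3 * N)%N = 0.
  have gE : g ^+ 2 = qneg (u ^+ 2) by rewrite rmorphXn /= qnegK.
  (* At an odd exponent u^2 and g^2 have opposite coefficients, so O yields 2 u^2, and 2 = -1 modulo
     3. *)
  move: O3N; rewrite /O coef_fpsB gE coef_qneg -signr_odd oddM oddN expr1.
  move=> E; transitivity (3 * (u ^+ 2) (3 * N)%N -
     ((u ^+ 2) (3 * N)%N - -1 * (u ^+ 2) (3 * N)%N)); first by ring.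
  by rewrite E three0; ring.
have g6N : g (6 * N)%N = 0.
  (* At an even exponent g and u agree, so twice the coefficient of g is twice that of u^2 at 3N. *)
  move: gDu => /fpsP/(_ (6 * N)%N); rewrite coef_fpsD coef_fpsMn coef_qneg.
  rewrite -rmorphXn coef_qpow -signr_odd oddM expr0 -[6%N]/(2 * 3)%N -mulnA.
  rewrite dvdn_mulr// mulKn// u3N mul0rn => E.
  transitivity (3 * g (2 * (3 * N))%N -
     (g (2 * (3 * N))%N + 1 * g (2 * (3 * N))%N)); first by ring.
  by rewrite E three0; ring.
by rewrite (dvdz_pcharf (pchar_Fp (isT : prime 3))); apply/eqP.
Qed.

(** * Factoring the argument and combining the moduli 3 and 4 *)

Theorem theorem4p8 (p alpha n : nat) (hp : prime p)
    (hp6 : (p = 5 %[mod 6])%N) (hleg : legendre (-3) p = -1) :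
  forall i : nat, (1 <= i <= p - 1)%N ->
    (S3bar (36 * p ^ (2 * alpha + 2) * n
            + 6 * (6 * i + p) * p ^ (2 * alpha + 1))%N = 0 %[mod 12])%Z.
Proof.
move=> i /andP[i_gt0 i_lt].
have p3 : (3 < p)%N by case: p hp hp6 {hleg i_lt} => [|[|[|[|]]]].
have podd : odd p by move: hp6; lia.
have pN6 : ~~ (p %| 6)%N.
  by rewrite -[6%N]/(2 * 3)%N Euclid_dvdM// !(dvdn_prime2 hp)//; lia.
(* The cofactor of 6 p^(2 alpha + 1) in the argument: it is odd, and prime to p because p divides
   neither 6 nor i. *)
set M := (6 * p * n + 6 * i + p)%N.
have -> : (36 * p ^ (2 * alpha + 2) * n + 6 * (6 * i + p) * p ^ (2 * alpha + 1) =
    6 * (p ^ (2 * alpha + 1) * M))%N.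
  by rewrite /M addnS [(p ^ _.+1)%N]expnS addn1; ring.
set N := (p ^ _ * M)%N.
have oddN : odd N.
  by rewrite oddM oddX podd orbT /M -mulnA -mulnDr oddD (oddM 6) podd.
have pM : ~~ (p %| M)%N.
  rewrite /M dvdn_addl// -mulnA -mulnDr Euclid_dvdM// (negbTE pN6) /=.
  rewrite dvdn_addr ?dvdn_mulr//; apply/negP => /(dvdn_leq i_gt0); lia.
have logN : odd (logn p (6 * N)).
  rewrite logn_Gauss ?prime_coprime// /N mulnC logn_Gauss ?prime_coprime//.
  by rewrite pfactorK// addn1 /= oddM.
apply/eqP; rewrite eqz_mod_dvd subr0 (@Gauss_dvdz 3 4)//.
by rewrite S3bar_mod3// (S3bar_mod4 hp).
Qed.
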